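(* Let $x_m>0$, let $f:(0,x_m]\to(0,\infty)$ be integrable, let $\rho>0$, and let $c\in\mathbb{R}$. Over the class of all Riemann integrable retention functions $r:(0,x_m]\to\mathbb{R}$ satisfying $0\le r(x)\le x$ for all $x\in(0,x_m]$, consider the policy value functional $$V_{ins}[r]=\rho\int_0^{x_m}f(x)\left(e^{x/\rho}-e^{r(x)/\rho}-(1+c)\left(\frac{x}{\rho}-\frac{r(x)}{\rho}\right)\right)dx .$$ (a) If $c>0$, then $V_{ins}$ attains its maximum over this class at the straight deductible $$\overline{r}(x)=\begin{cases}x, & x\le\rho\ln(1+c),\\ \rho\ln(1+c), & x>\rho\ln(1+c),\end{cases}$$ whose deductible value is $\overline F=\rho\ln(1+c)$. (b) If $c\le 0$, then $V_{ins}$ attains its maximum over this class at $\overline r(x)=0$ for all $x\in(0,x_m]$.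
   Context: Here $f$ is the expected loss function ($\int_{x_1}^{x_2}f(x)\,dx$ is the expected number of losses per year with value in $(x_1,x_2]\subseteq(0,x_m]$), $r(x)$ is the part of a loss of value $x$ retained by the Insured, $\rho$ is the risk tolerance of an Insured with disutility $U(l)=\rho(e^{l/\rho}-1)$, and $c$ is the loading coefficient of a risk-neutral Insurer charging the premium $P=(1+c)\int_0^{x_m}f(x)(x-r(x))\,dx$. $V_{ins}[r]$ is the value of the policy for the Insured (certain equivalent of the yearly total loss minus certain equivalent of the yearly total retention plus premium), and a retention function is called Pareto-optimal when it maximizes $V_{ins}$ subject to $0\le r(x)\le x$. *)

(* Defs.v *)
From mathcomp Require Import all_boot all_order all_algebra.
From mathcomp Require Import all_classical all_reals all_analysis.
From mathcomp Require Import Rstruct Rstruct_topology.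
From Stdlib Require Rdefinitions RiemannInt.

Set Implicit Arguments.
Unset Strict Implicit.
Unset Printing Implicit Defensive.

Import Order.TTheory GRing.Theory Num.Theory.
Import numFieldNormedType.Exports.

Local Open Scope classical_set_scope.
Local Open Scope ring_scope.

(* The reals are those of the standard library, whose Riemann integrability
   is used for retention functions; the order, expR and ln are the generic
   ones of realType.  Functions on (0, xm] are total functions R -> R whose
   values outside (0, xm] are irrelevant. *)
Notation R := Rdefinitions.R.

(* Completed, so that Riemann integrable functions, which need not be Borel,
   are measurable. *)
Notation mu := (@completed_lebesgue_measure R).

(* Riemann_integrable lives in Type, whence inhabited.  It does not depend on
   the value of r at the endpoint 0. *)
Definition retention (xm : R) (r : R -> R) : Prop :=
  inhabited (RiemannInt.Riemann_integrable r 0 xm) /\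
  (forall x : R, 0 < x <= xm -> 0 <= r x <= x).

(* The integrand is integrable whenever f is and r is a retention function,
   so this is a genuine Lebesgue integral there. *)
Definition V_ins (xm : R) (f : R -> R) (rho c : R) (r : R -> R) : R :=
  rho * \int[mu]_(x in `]0, xm])
    (f x * (expR (x / rho) - expR (r x / rho)
            - (1 + c) * (x / rho - r x / rho))).

Definition straight_deductible (F : R) (x : R) : R := if x <= F then x else F.

Definition maximizes (T : Type) (C : T -> Prop) (J : T -> R) (t : T) : Prop :=
  C t /\ forall s : T, C s -> J s <= J t.

(* Main.v *)
Require Import Defs.
From mathcomp Require Import all_boot all_order all_algebra.
From mathcomp Require Import all_classical all_reals all_analysis.
From mathcomp Require Import Rstruct Rstruct_topology.
From mathcomp Require Import measurable_realfun lra.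
From Stdlib Require Rdefinitions RiemannInt_SF RiemannInt.

Set Implicit Arguments.
Unset Strict Implicit.
Unset Printing Implicit Defensive.

Import Order.TTheory GRing.Theory Num.Theory.
Import numFieldNormedType.Exports.
Import RiemannInt_SF.

Local Open Scope classical_set_scope.
Local Open Scope ring_scope.

(** The maximization is pointwise.  With u = y / rho and v = z / rho, retaining
    z instead of y at a loss x changes the integrand by f x times
    e^u - e^v - (1 + c) (u - v), which is at least (e^v - (1 + c)) (u - v) by
    convexity of exp.  For the claimed optimum z this is nonnegative: either
    e^v = 1 + c, or z is the endpoint of [0, x] at which the sign of
    e^v - (1 + c) pushes the minimum.

    Comparing the integrals requires both integrands to be integrable, hence
    a Riemann integrable r to be measurable for the completed Lebesgue
    measure.  Step functions phi n and psi n with |r - phi n| <= psi n and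
    integral of psi n at most 1 / (n + 1) give inf_n psi n = 0 almost
    everywhere, so r = sup_n (phi n - psi n) almost everywhere. *)

(** * Measurability by approximation, for a complete measure *)

Lemma measurable_fun_squeeze d (T : measurableType d) (K : realType)
    (nu : {measure set T -> \bar K}) (D : set T) (f : T -> K)
    (phi psi : nat -> T -> K) :
  measure_is_complete nu -> measurable D ->
  (forall n, measurable_fun D (phi n)) ->
  (forall n, measurable_fun D (psi n)) ->
  (forall n x, D x -> `|f x - phi n x| <= psi n x) ->
  (forall n, (\int[nu]_(x in D) (psi n x)%:E <= n.+1%:R^-1%:E)%E) ->
  measurable_fun D f.
Proof.
move=> cnu mD mphi mpsi fphi int_psi.
have psi_ge0 n x : D x -> 0 <= psi n x.
  by move=> Dx; apply: le_trans (fphi n x Dx).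
pose h x : \bar K := einfs (fun n => (psi n x)%:E) 0%N.
have mh : measurable_fun D h.
  by apply: measurable_fun_einfs => n; exact/measurable_EFinP.
have h_le n x : (h x <= (psi n x)%:E)%E.
  by apply: ereal_inf_lbound; exists n.
have h_ge0 x : D x -> (0 <= h x)%E.
  move=> Dx; apply: le_ereal_inf_tmp => _ [n _ <-].
  by rewrite lee_fin psi_ge0.
(* Since 0 <= [h] <= [psi n] on [D], the integral of [h] is at most 1 / (n + 1) for every n. *)
have int_h : (\int[nu]_(x in D) `|h x| = 0)%E.
  under eq_integral => x /[!inE] Dx do rewrite gee0_abs ?h_ge0//.
  apply/eqP; rewrite eq_le integral_ge0// andbT.
  apply/lee_addgt0Pr => e e_gt0; rewrite add0e.
  have [n /ltW ne] : exists n, n.+1%:R^-1 < e.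
    have [n _ ne] := @near_infty_natSinv_lt K (PosNum e_gt0).
    by exists n; exact: (ne n (leqnn n)).
  apply: le_trans (le_trans (int_psi n) _); last by rewrite lee_fin.
  by apply: ge0_le_integral => //; exact/measurable_EFinP.
pose g x : \bar K := esups (fun n => (phi n x - psi n x)%:E) 0%N.
have mg : measurable_fun D g.
  apply: measurable_fun_esups => n; apply/measurable_EFinP.
  exact: measurable_funB.
apply/measurable_EFinP; apply: (ae_measurable_fun cnu _ mg).
have [/(_ int_h) h_ae0 _] := ae_eq_integral_abs nu mD mh.
apply: filterS h_ae0 => x /= hx0 Dx; have {}hx0 := hx0 Dx.
apply/eqP; rewrite eq_le; apply/andP; split.
  apply: ge_ereal_sup => _ [n _ <-]; rewrite lee_fin.
  by have := fphi n x Dx; rewrite ler_norml; lra.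
apply/lee_addgt0Pr => e e_gt0.
(* [f x] <= [phi n x + psi n x] exceeds the term [phi n x - psi n x] of the supremum by at most
   twice [psi n x], so [psi n x] < e / 2 suffices. *)
have : (h x < (e / 2)%:E)%E by rewrite hx0 lte_fin; lra.
move=> /ereal_inf_lt [_ [n _ <-]]; rewrite lte_fin => psi_lt.
apply: (@le_trans _ _ ((phi n x - psi n x)%:E + e%:E)%E).
  by rewrite -EFinD lee_fin; have := fphi n x Dx; rewrite ler_norml; lra.
by apply: leeD2r; apply: ereal_sup_ubound; exists n.
Qed.

(** * Step functions and Riemann integrable functions *)

Notation cR := (caratheodory_type (wlength (@idfun R))^*%mu).
(* The Borel structure is canonical on [Real.sort _], but not on the bare
   [Rdefinitions.R]. *)
Notation bR := (measurableTypeR R).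

Lemma measurable_completed (A : set R) :
  measurable (A : set bR) -> measurable (A : set cR).
Proof. exact: sub_caratheodory. Qed.

Lemma completed_lebesgue_itvoc (a b : R) : a <= b ->
  mu `]a, b] = (b - a)%:E.
Proof.
move=> ab; rewrite [LHS](lebesgue_measure_itv `]a, b]) /= lte_fin.
by case: ltgtP ab => // -> _; rewrite subrr.
Qed.

(** The value at [b] is arbitrary, but a single point is null, so [psi] agrees almost everywhere
    with a constant. *)
Lemma integral_const_on_open (psi : R -> R) (a b k : R) : a <= b ->
  (forall x, a < x < b -> psi x = k) ->
  measurable_fun (`]a, b] : set cR) (psi : cR -> bR) /\
  (\int[mu]_(x in `]a, b]) (psi x)%:E = (k * (b - a))%:E)%E.
Proof.
move=> ab psik.
have mab : measurable (`]a, b] : set cR) by exact: measurable_completed.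
have mb : measurable ([set b] : set cR) by exact: measurable_completed.
have ae_psi : ae_eq mu (`]a, b]%classic : set cR) (EFin \o cst k) (EFin \o psi).
  exists [set b]; split => //; first exact: (lebesgue_measure_set1 b).
  move=> x /= /not_implyP[] /=; rewrite in_itv /= => /andP[ax xb] px.
  apply/eqP; move: xb; rewrite le_eqVlt => /orP[//|xb].
  by case: px; rewrite psik ?ax.
have mpsi : measurable_fun (`]a, b] : set cR) (EFin \o psi).
  apply: (ae_measurable_fun completed_lebesgue_measure_is_complete ae_psi).
  exact/measurable_EFinP.
split; first exact/measurable_EFinP.
rewrite -(ae_eq_integral _ _ mab _ mpsi ae_psi); last exact/measurable_EFinP.
rewrite (integral_cst _ mab k%:E) EFinM; congr (_ * _)%E.
exact: completed_lebesgue_itvoc.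
Qed.

(** By induction on the subdivision, splitting off its first interval. The sign condition guards
    only the integral, since measurability is also used for the approximants [phi n], which may
    change sign. *)
Lemma adapted_couple_integral (psi : R -> R) (l : list R) :
  forall (a b : R) (lf : list R), a <= b -> adapted_couple psi a b l lf ->
  measurable_fun (`]a, b] : set cR) (psi : cR -> bR) /\
  ((forall x, a < x <= b -> 0 <= psi x) ->
   (\int[mu]_(x in `]a, b]) (psi x)%:E = (Int_SF lf l)%:E)%E).
Proof.
elim: l => [|s l IH] a b lf ab ad; first by case: ad => _ [_ [_ []]].
have := ad; rewrite /adapted_couple RminE RmaxE (min_idPl ab) (max_idPr ab).
case: l IH ad => [_ _|t l IH ad].
  case=> _ [/= <-] [<-] _.
  rewrite set_itvoc0 //; split=> [|_]; first exact: measurable_fun_set0.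
  by rewrite integral_set0; case: lf.
case: lf ad => [_ [_ [_ [_ []]]] // | k lf ad].
case=> ord [/= sa] [lb] [_ /(_ 0%N)]; rewrite /= sa => psik.
have at_ : a <= t.
  by rewrite -sa; apply/RleP; apply: (ord 0%N); apply/ssrnat.ltP.
have tb : t <= b.
  rewrite -lb; apply/RleP; have := RList.RList_P7 _ t ord; apply.
  by right; left.
have psi_k x : a < x < t -> psi x = k.
  move=> /andP[/RltP ax /RltP xt].
  by apply: psik; [exact/ssrnat.ltP | split].
(* [StepFun_P7] drops the first interval and leaves an adapted couple on [t, b]. *)
have [mtb itb] := IH t b lf tb (StepFun_P7 (RleP ab) ad).
have [mat iat] := integral_const_on_open at_ psi_k.
have oc_meas x y : measurable (`]x, y] : set cR) by exact: measurable_completed.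
have abU : `]a, b]%classic = (`]a, t] `|` `]t, b])%classic :> set R.
  by rewrite -itv_bndbnd_setU ?bnd_simp.
have mab : measurable_fun (`]a, b] : set cR) (psi : cR -> bR).
  by rewrite abU; apply/measurable_funU.
split=> // psi_ge0; rewrite abU ge0_integral_setU //.
- rewrite iat itb /=; last first.
    by move=> x /andP[tx xb]; rewrite psi_ge0 // xb (le_lt_trans at_ tx).
  by rewrite -EFinD -RmultE -RminusE.
- by rewrite -abU; exact/measurable_EFinP.
- by move=> x; rewrite -abU /= in_itv /= => xab; rewrite lee_fin psi_ge0.
- apply/disj_setPS => x [/=]; rewrite !in_itv /= => /andP[_ xt] /andP[tx _].
  by move: (lt_le_trans tx xt); rewrite ltxx.
Qed.

Lemma StepFun_measurable (a b : R) (psi : StepFun a b) : a <= b ->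
  measurable_fun (`]a, b] : set cR) (psi : cR -> bR).
Proof.
by move=> ab; have [] := adapted_couple_integral ab (StepFun_P1 psi).
Qed.

Lemma StepFun_integral (a b : R) (psi : StepFun a b) : a <= b ->
  (forall x, a < x <= b -> 0 <= psi x) ->
  (\int[mu]_(x in `]a, b]) (psi x)%:E = (RiemannInt_SF psi)%:E)%E.
Proof.
move=> ab psi_ge0.
have [_ ->//] := adapted_couple_integral ab (StepFun_P1 psi).
rewrite /RiemannInt_SF; case: RIneq.Rle_dec => // nab.
by case: nab; exact/RleP.
Qed.

Lemma Riemann_integrable_measurable (a b : R) (r : R -> R) : a <= b ->
  inhabited (RiemannInt.Riemann_integrable r a b) ->
  measurable_fun (`]a, b] : set cR) (r : cR -> bR).
Proof.
move=> ab [ri].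
have /choice[phipsi /all_and2[r_phi int_psi]] (n : nat) :
    exists p : StepFun a b * StepFun a b,
      (forall x, a < x <= b -> `|r x - p.1 x| <= p.2 x) /\
      RiemannInt_SF p.2 <= n.+1%:R^-1.
  have inv_gt0 : Rdefinitions.Rlt 0 (n.+1%:R^-1 : R).
    by apply/RltP; rewrite invr_gt0.
  have [phi [psi [r_phi int_psi]]] := ri (RIneq.mkposreal _ inv_gt0).
  exists (phi, psi); split=> [x /andP[ax xb]|].
    rewrite -RabsE; apply/RleP/r_phi.
    rewrite RminE RmaxE (min_idPl ab) (max_idPr ab).
    by split; apply/RleP => //; exact: ltW.
  (* Riemann integrability bounds the absolute value of the integral of [psi]. *)
  move: int_psi; rewrite RabsE => /RltP /ltW.
  exact: le_trans (ler_norm _).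
apply: (@measurable_fun_squeeze _ _ _ mu _ r
  (fun n => (phipsi n).1) (fun n => (phipsi n).2)) => //.
- exact: completed_lebesgue_measure_is_complete.
- exact: measurable_completed.
- by move=> n; exact: (StepFun_measurable (phipsi n).1 ab).
- by move=> n; exact: (StepFun_measurable (phipsi n).2 ab).
(* The error bound [psi n] dominates an absolute value, hence is nonnegative on ]a, b]. *)
- move=> n; have -> := StepFun_integral ab
    (fun x xab => le_trans (normr_ge0 _) (r_phi n x xab)).
  by rewrite lee_fin; exact: int_psi.
Qed.

(** * Pointwise maximization *)

(** The factor of [f x] in the integrand of [V_ins], with [y] the retained part of the loss [x]. *)
Definition policy_gain {K : realType} (rho c x y : K) : K :=
  expR (x / rho) - expR (y / rho) - (1 + c) * (x / rho - y / rho).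

Lemma expR_tangent (K : realType) (u v : K) :
  expR v * (u - v) <= expR u - expR v.
Proof.
have -> : expR u = expR v * expR (u - v) by rewrite -exp.expRD addrC subrK.
have := expR_ge1Dx (u - v); have := expR_gt0 v; nra.
Qed.

(** The gain is concave in the retained part, so the first-order condition at [z] in the direction
    of [y] suffices. *)
Lemma policy_gain_le (K : realType) (rho c x y z : K) :
  0 <= (expR (z / rho) - (1 + c)) * (y / rho - z / rho) ->
  policy_gain rho c x y <= policy_gain rho c x z.
Proof.
by rewrite /policy_gain; have := expR_tangent (y / rho) (z / rho); lra.
Qed.

Lemma policy_gain_le_deductible (K : realType) (rho c x y : K) :
  0 < rho -> 0 < c -> y <= x ->
  policy_gain rho c x y <=
    policy_gain rho c x (Num.min x (rho * ln (1 + c))).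
Proof.
move=> rho_gt0 c_gt0 yx; apply: policy_gain_le.
have dedE : expR (rho * ln (1 + c) / rho) = 1 + c.
  by rewrite mulrAC divff ?gt_eqF // mul1r lnK // posrE; lra.
case: (leP x (rho * ln (1 + c))) => [x_le|_]; last by rewrite dedE subrr mul0r.
(* Below the deductible z = x, and both factors are nonpositive. *)
apply: mulr_le0; rewrite subr_le0.
  by rewrite -dedE ler_expR ler_pM2r ?invr_gt0.
by rewrite ler_pM2r ?invr_gt0.
Qed.

Lemma policy_gain_le0 (K : realType) (rho c x y : K) :
  0 < rho -> c <= 0 -> 0 <= y ->
  policy_gain rho c x y <= policy_gain rho c x 0.
Proof.
move=> rho_gt0 c_le0 y_ge0; apply: policy_gain_le.
(* At z = 0 the product is -c * (y / rho). *)
rewrite mul0r exp.expR0 subr0 mulr_ge0 ?divr_ge0 // ?(ltW rho_gt0) //; lra.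
Qed.

(** * Integrability and comparison of policy values *)

Lemma measurable_policy_gain (rho c : R) (D : set cR) (g h : cR -> bR) :
  measurable_fun D g -> measurable_fun D h ->
  measurable_fun D (fun x => policy_gain rho c (g x) (h x) : bR).
Proof.
move=> mg mh.
have div_meas (k : cR -> bR) : measurable_fun D k ->
    measurable_fun D (fun x => k x / rho : bR).
  by move=> mk; apply: measurable_funM.
have exp_meas (k : cR -> bR) : measurable_fun D k ->
    measurable_fun D (fun x => expR (k x / rho) : bR).
  by move=> mk; apply: (measurableT_comp (@measurable_expR R)); exact: div_meas.
apply: measurable_funB; first by apply: measurable_funB; exact: exp_meas.
by apply: measurable_funM => //; apply: measurable_funB; exact: div_meas.
Qed.

(** A bound independent of [x] and [y], so that the product of the gain with the integrable [f] is
    integrable. *)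
Lemma policy_gain_bound (K : realType) (rho c x y M : K) : 0 < rho ->
  0 <= y <= x -> x <= M ->
  `|policy_gain rho c x y| <= expR (M / rho) + `|1 + c| * (M / rho).
Proof.
move=> rho_gt0 /andP[y_ge0 yx] xM; rewrite /policy_gain.
have yx_rho : y / rho <= x / rho by rewrite ler_pM2r ?invr_gt0.
have xM_rho : x / rho <= M / rho by rewrite ler_pM2r ?invr_gt0.
have y_rho : 0 <= y / rho by rewrite divr_ge0 // ltW.
apply: le_trans (ler_normB _ _) _; apply: lerD.
  have : expR (y / rho) <= expR (x / rho) by rewrite ler_expR.
  have : expR (x / rho) <= expR (M / rho) by rewrite ler_expR.
  by have := expR_gt0 (y / rho); rewrite ler_norml; lra.
by rewrite normrM ler_wpM2l // ger0_norm; lra.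
Qed.

Lemma V_ins_integrable (xm : R) (f : R -> R) (rho c : R) (r : R -> R) :
  0 < xm -> 0 < rho -> mu.-integrable `]0, xm] (EFin \o f) ->
  retention xm r ->
  mu.-integrable `]0, xm] (EFin \o (fun x => f x * policy_gain rho c x (r x))).
Proof.
move=> xm_gt0 rho_gt0 f_int [ri r_bd].
have mr := Riemann_integrable_measurable (ltW xm_gt0) ri.
have mid : measurable_fun (`]0, xm]%classic : set cR) (id : cR -> bR).
  by move=> mD B mB; apply: measurableI => //; exact: measurable_completed.
have m0xm : measurable (`]0, xm]%classic : set cR).
  exact: measurable_completed.
have mgain := measurable_policy_gain rho c mid mr.
have bgain :
    [bounded (policy_gain rho c x (r x) : R^o) | x in `]0, xm]%classic].
  exists (expR (xm / rho) + `|1 + c| * (xm / rho)).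
  split; first exact: num_real.
  move=> M lt_M x /=; rewrite in_itv /= => /andP[x_gt0 x_le].
  apply: le_trans (ltW lt_M); apply: policy_gain_bound => //.
  by apply: r_bd; rewrite x_gt0.
exact: (integrableMl m0xm f_int mgain bgain).
Qed.

Lemma V_ins_le (xm : R) (f : R -> R) (rho c : R) (r s : R -> R) :
  0 < xm -> 0 < rho -> (forall x, 0 < x <= xm -> 0 <= f x) ->
  mu.-integrable `]0, xm] (EFin \o f) ->
  retention xm r -> retention xm s ->
  (forall x, 0 < x <= xm ->
    policy_gain rho c x (r x) <= policy_gain rho c x (s x)) ->
  V_ins xm f rho c r <= V_ins xm f rho c s.
Proof.
move=> xm_gt0 rho_gt0 f_ge0 f_int ret_r ret_s gain_le.
rewrite /V_ins ler_pM2l //; apply: le_Rintegral.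
- exact: measurable_completed.
- exact: V_ins_integrable.
- exact: V_ins_integrable.
- by move=> x; rewrite /= in_itv /= => x_in; rewrite ler_wpM2l ?f_ge0 ?gain_le.
Qed.

(** * Admissibility of the optima and conclusion *)

(** As a minimum, the deductible is visibly continuous, hence Riemann integrable. *)
Lemma straight_deductibleE (F : R) :
  straight_deductible F = (fun x => Num.min x F).
Proof.
by apply/funext => x; rewrite minElt /straight_deductible; case: ltgtP.
Qed.

Lemma retention_straight_deductible (xm F : R) : 0 < xm -> 0 <= F ->
  retention xm (straight_deductible F).
Proof.
move=> xm_gt0 F_ge0; rewrite straight_deductibleE; split; last first.
  by move=> x /andP[x_gt0 _]; rewrite le_min (ltW x_gt0) F_ge0 ge_min lexx.
constructor; apply: RiemannInt.continuity_implies_RiemannInt.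
  exact/RleP/ltW.
move=> x _; apply/continuity_ptE.
by apply: (@continuous_min _ _ id (cst F)); [exact: cvg_id | exact: cvg_cst].
Qed.

Lemma retention_0 (xm : R) : retention xm (fun=> 0).
Proof.
split; first by constructor; exact: RiemannInt.RiemannInt_P14.
by move=> x /andP[x_gt0 _]; rewrite lexx ltW.
Qed.

Theorem mainTheorem3 (xm : R) (xm_gt0 : 0 < xm)
    (f : R -> R) (f_gt0 : forall x : R, 0 < x <= xm -> 0 < f x)
    (f_int : mu.-integrable `]0, xm] (fun x => (f x)%:E))
    (rho : R) (rho_gt0 : 0 < rho) (c : R) :
  (0 < c ->
    maximizes (retention xm) (V_ins xm f rho c)
      (straight_deductible (rho * ln (1 + c)))) /\
  (c <= 0 ->
    maximizes (retention xm) (V_ins xm f rho c) (fun=> 0)).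
Proof.
have f_ge0 x : 0 < x <= xm -> 0 <= f x by move=> /f_gt0 /ltW.
split=> [c_gt0|c_le0].
  have ret_d : retention xm (straight_deductible (rho * ln (1 + c))).
    apply: retention_straight_deductible => //.
    by rewrite mulr_ge0 ?(ltW rho_gt0) // ln_ge0 //; lra.
  split=> // r ret_r; apply: V_ins_le => // x /(proj2 ret_r) /andP[_ rx].
  by rewrite straight_deductibleE; exact: policy_gain_le_deductible.
split=> [|r ret_r]; first exact: retention_0.
apply: V_ins_le => //; first exact: retention_0.
by move=> x /(proj2 ret_r) /andP[rx _]; exact: policy_gain_le0.
Qed.
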